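(* Let $(P,\lhd)$ be an interval-poset of size $n$. Then the rise $\mathrm{Ri}(P)$ of $P$ is an interval-poset if and only if $P$ is modern.
   Context: An interval-poset of size $n$ is a (reflexive) partial order $\lhd$ on $\{1,\dots,n\}$ such that for all $a<b<c$: $a\lhd c$ implies $b\lhd c$, and $c\lhd a$ implies $b\lhd a$. It is modern if there are no $x<y<z$ with both $x\lhd y$ and $z\lhd y$ (all relations are considered, not only cover relations). Rise: for a reflexive binary relation $\lhd$ on $P=\{1,\dots,n\}$, its rise $\mathrm{Ri}(P)$ is the set $\{1,\dots,n+1\}$ with the reflexive relation $\lhd_R$ defined by: for $x<y\le n$, $y\lhd_R x$ if and only if $y\lhd x$; for $1<x<y\le n+1$, $x\lhd_R y$ if and only if $x-1\lhd y-1$; no other relations between distinct elements. *)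

(* Defs.v *)
From mathcomp Require Import all_boot.

Set Implicit Arguments.
Unset Strict Implicit.
Unset Printing Implicit Defensive.

(* The ground set {1, ..., n} is 'I_n: the ordinal i stands for the label i + 1.
   [r x y] reads "x is below y", and [(x < y)%N] compares labels. *)

Definition interval_poset (n : nat) (r : rel 'I_n) : Prop :=
  [/\ reflexive r, antisymmetric r, transitive r &
      forall a b c : 'I_n, (a < b)%N -> (b < c)%N ->
        (r a c -> r b c) /\ (r c a -> r b a)].

Definition modern (n : nat) (r : rel 'I_n) : Prop :=
  ~ exists x y z : 'I_n, [/\ (x < y)%N, (y < z)%N, r x y & r z y].

(* Decreasing relations keep their labels (widen_ord preserves the value);
   increasing relations have both labels shifted by one (lift ord0 a has
   value a.+1). *)
Definition rise (n : nat) (r : rel 'I_n) : rel 'I_n.+1 := fun u v =>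
  [|| u == v,
      [exists x : 'I_n, exists y : 'I_n,
        [&& (x < y)%N, r y x,
            u == widen_ord (leqnSn n) y & v == widen_ord (leqnSn n) x]]
    | [exists x : 'I_n, exists y : 'I_n,
        [&& (x < y)%N, r x y, u == lift ord0 x & v == lift ord0 y]]].

(* Main.v *)
Require Import Defs.
From mathcomp Require Import all_boot.
From mathcomp Require Import zify.

(** The rise superposes two halves of the order: the decreasing relations,
    left in place, and the increasing ones, translated by one.  Everything
    depends on how the two halves meet at neighbouring labels.

    If [x < y < z] with [x] and [z] both below [y], the translated relation
    [x+1 <| y+1] and the untouched relation [z <| y] overlap.  In an
    interval-poset the first forces [y <| y+1] and the second [y+1 <| y], which
    antisymmetry forbids ([modern_of_rise]).

    Conversely, each half of the rise inherits the interval condition, and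
    transitivity within a half, from the original order; only the interaction
    of an increasing relation with a decreasing one is at stake
    ([rise_label_anti], [rise_label_trans]).  In the original order an
    increasing [a <| b] gives [k <| b] for all [a <= k < b], and a decreasing
    [c <| a] gives [k <| a] for all [a < k <= c].  Hence after undoing the
    translation the two relations still chain, except when they both end at one
    label from opposite sides, which modernity excludes.

    The translation makes it convenient to argue about labels in [nat], where
    [i.+1] does not change the type, and to return to ordinals through
    [riseP]. *)

Set Implicit Arguments.
Unset Strict Implicit.
Unset Printing Implicit Defensive.

Definition label_rel (n : nat) (r : rel 'I_n) (i j : nat) : Prop :=
  exists x y : 'I_n, [/\ i = x, j = y & r x y].

(** As a relation on all of [nat] the rise does not mention the size; adding
    the whole diagonal is harmless because only labels of actual elements are
    ever compared with it. *)
Inductive rise_label (s : nat -> nat -> Prop) : nat -> nat -> Prop :=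
| RiseRefl i : rise_label s i i
| RiseDecr i j : j < i -> s i j -> rise_label s i j
| RiseIncr i j : i < j -> s i j -> rise_label s i.+1 j.+1.

Lemma riseP n (r : rel 'I_n) (u v : 'I_n.+1) :
  reflect (rise_label (label_rel r) u v) (rise r u v).
Proof.
apply: (iffP or3P) => [[/eqP -> | /existsP[x /existsP[y]] |
                        /existsP[x /existsP[y]]] | ].
- exact: RiseRefl.
- by case/and4P=> lt_xy r_yx /eqP-> /eqP->; apply: RiseDecr => //; exists y, x.
- case/and4P=> lt_xy r_xy /eqP-> /eqP->; rewrite !lift0.
  by apply: RiseIncr => //; exists x, y.
move Eu: (nat_of_ord u) => i; move Ev: (nat_of_ord v) => j ruv.
case: ruv Eu Ev => {i j} [i | i j lt_ji [x [y [ix jy rxy]]] |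
                          i j lt_ij [x [y [ix jy rxy]]]] Eu Ev.
- by constructor 1; apply/eqP/val_inj; rewrite /= Eu Ev.
- constructor 2; apply/existsP; exists y; apply/existsP; exists x.
  by rewrite -ix -jy lt_ji rxy -!val_eqE /= Eu Ev ix jy !eqxx.
- constructor 3; apply/existsP; exists x; apply/existsP; exists y.
  by rewrite -ix -jy lt_ij rxy -!val_eqE /= /bump /= !add1n Eu Ev ix jy !eqxx.
Qed.

Section RiseLabel.

Variable s : nat -> nat -> Prop.

Hypothesis s_anti : forall i j, s i j -> s j i -> i = j.
Hypothesis s_trans : forall i j k, s i j -> s j k -> s i k.
Hypothesis s_incr : forall a b c, a < b -> b < c -> s a c -> s b c.
Hypothesis s_decr : forall a b c, a < b -> b < c -> s c a -> s b a.
Hypothesis s_modern : forall x y z, x < y -> y < z -> s x y -> s z y -> False.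

Lemma rise_label_interval a b c : a < b -> b < c ->
  (rise_label s a c -> rise_label s b c) /\
  (rise_label s c a -> rise_label s b a).
Proof.
move=> lt_ab lt_bc; split=> H.
- case: H lt_ab lt_bc => [i | i j lt_ji _ | i j lt_ij sij]; try lia.
  case: b => [|b] lt_ib lt_bj; first by lia.
  by apply: RiseIncr; [lia | apply: (s_incr (a := i)) => //; lia].
- case: H lt_ab lt_bc => [i | i j lt_ji sij | i j lt_ij _]; try lia.
  by move=> lt_jb lt_bi; apply: RiseDecr => //; apply: s_decr lt_bi sij.
Qed.

(** The interval condition fills in everything strictly between [i] and [j],
    hence makes [i.+1] and [j] mutually related; this collapses them, and then
    [j] is the middle of a pattern that modernity forbids. *)
Lemma no_opposite_rise i j : i < j -> s i j -> s j.+1 i.+1 -> False.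
Proof.
move=> lt_ij sij sji.
have [eq_j | lt_ij1] : j = i.+1 \/ i.+1 < j by lia.
  by subst j; apply: s_modern sij sji.
have /s_anti/(_ (s_decr _ _ sji)) := s_incr (ltnSn i) lt_ij1 sij.
by lia.
Qed.

Lemma rise_label_anti u v : rise_label s u v -> rise_label s v u -> u = v.
Proof.
case=> [//|i j lt_ji sij|i j lt_ij sij].
- move Ea: {1}j => a; move Eb: {1}i => b H.
  case: a b / H Ea Eb => [//|a b|a b _ sab] *; try lia.
  by subst i j; case: (@no_opposite_rise a b).
- move Ea: {1}j.+1 => a; move Eb: {1}i.+1 => b H.
  case: a b / H Ea Eb => [//|a b _ sab|a b] *; try lia.
  by subst a b; case: (@no_opposite_rise i j).
Qed.

(** Going up to [j.+1] and then down to [w]: modernity rules out [w = j], so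
    both relations can be rerouted through [j]. *)
Lemma rise_label_up_down i j w :
  i < j -> s i j -> w < j.+1 -> s j.+1 w -> rise_label s i.+1 w.
Proof.
move=> lt_ij sij lt_wj sjw.
have [eq_w | lt_wj'] : w = j \/ w < j by lia.
  by subst w; case: (s_modern lt_ij (ltnSn j) sij sjw).
have {}sjw : s j w by apply: s_decr sjw.
case: (ltngtP w i.+1) => [lt_wi | lt_iw | ->]; last exact: RiseRefl.
- apply: RiseDecr => //.
  have [<- // | lt_ij1] : j = i.+1 \/ i.+1 < j by lia.
  exact: s_trans (s_incr (ltnSn i) lt_ij1 sij) sjw.
(* Past [i.+1], the label [w] would be both below and above [j]. *)
- have swj : s w j by apply: (s_incr (a := i)) => //; lia.
  by have := s_anti swj sjw; lia.
Qed.

(** Going down to [i.+1] and then up to [j.+1]: in the original order [u] is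
    below [j], and so is [i]; modernity keeps [u] from lying beyond [j]. *)
Lemma rise_label_down_up u i j :
  i.+1 < u -> s u i.+1 -> i < j -> s i j -> rise_label s u j.+1.
Proof.
move=> lt_iu sui lt_ij sij.
have suj : s u j.
  have [-> // | lt_ij1] : j = i.+1 \/ i.+1 < j by lia.
  exact: s_trans sui (s_incr (ltnSn i) lt_ij1 sij).
have le_uj : u <= j.
  by rewrite leqNgt; apply/negP=> lt_ju; apply: s_modern lt_ij lt_ju sij suj.
case: u lt_iu {sui suj} le_uj => [//|u] lt_iu le_uj.
by apply: RiseIncr => //; apply: (s_incr (a := i)).
Qed.

Lemma rise_label_trans u v w :
  rise_label s u v -> rise_label s v w -> rise_label s u w.
Proof.
case=> [//|i j lt_ji sij|i j lt_ij sij].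
- move Ek: j => k H.
  case: k w / H Ek => [k <-|k l lt_lk skl ejk|k l lt_kl skl ejk].
  + exact: RiseDecr.
  + subst k; apply: RiseDecr; [exact: ltn_trans lt_ji | exact: s_trans skl].
  + by subst j; apply: rise_label_down_up sij lt_kl skl.
- move Ek: j.+1 => k H.
  case: k w / H Ek => [k <-|k l lt_lk skl ejk|k l lt_kl skl [ejk]].
  + exact: RiseIncr.
  + by subst k; apply: rise_label_up_down skl.
  + subst k; apply: RiseIncr; [exact: ltn_trans lt_kl | exact: s_trans skl].
Qed.

End RiseLabel.

Section LabelRel.

Variables (n : nat) (r : rel 'I_n).
Hypothesis hr : interval_poset r.

Lemma label_rel_anti i j : label_rel r i j -> label_rel r j i -> i = j.
Proof.
move: hr => [_ anti _ _] [x [y [-> -> rxy]]]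
  [y' [x' [/val_inj <- /val_inj <- ryx]]].
by congr nat_of_ord; apply: anti; rewrite rxy.
Qed.

Lemma label_rel_trans i j k :
  label_rel r i j -> label_rel r j k -> label_rel r i k.
Proof.
case: hr => _ _ trans _ [x [y [-> -> rxy]]] [y' [z [/val_inj <- -> ryz]]].
by exists x, z; split=> //; apply: trans ryz.
Qed.

Lemma label_rel_incr a b c :
  a < b -> b < c -> label_rel r a c -> label_rel r b c.
Proof.
case: hr => _ _ _ intv lt_ab lt_bc [x [z [ax cz rxz]]].
have lt_bn : b < n by have := ltn_ord z; lia.
exists (Ordinal lt_bn), z; split=> //.
rewrite ax cz in lt_ab lt_bc.
by have [+ _] := intv x (Ordinal lt_bn) z lt_ab lt_bc; apply.
Qed.

Lemma label_rel_decr a b c :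
  a < b -> b < c -> label_rel r c a -> label_rel r b a.
Proof.
case: hr => _ _ _ intv lt_ab lt_bc [z [x [cz ax rzx]]].
have lt_bn : b < n by have := ltn_ord z; lia.
exists (Ordinal lt_bn), x; split=> //.
rewrite ax cz in lt_ab lt_bc.
by have [_] := intv x (Ordinal lt_bn) z lt_ab lt_bc; apply.
Qed.

Lemma label_rel_modern : modern r -> forall x y z,
  x < y -> y < z -> label_rel r x y -> label_rel r z y -> False.
Proof.
move=> mod_r i j k lt_ij lt_jk [x [y [ix jy rxy]]] [z [y' [kz]]].
rewrite jy => /val_inj <- rzy.
by apply: mod_r; exists x, y, z; split=> //; lia.
Qed.

End LabelRel.

Lemma modern_of_rise n (r : rel 'I_n) : interval_poset (rise r) -> modern r.
Proof.
case=> _ anti _ intv [x [y [z [lt_xy lt_yz rxy rzy]]]].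
have incr : rise r (lift ord0 x) (lift ord0 y).
  by apply/riseP; rewrite !lift0; apply: RiseIncr => //; exists x, y.
have decr : rise r (widen_ord (leqnSn n) z) (widen_ord (leqnSn n) y).
  by apply/riseP; apply: RiseDecr => //; exists z, y.
(* The interval condition needs strict inequalities: when [x.+1 = y] or
   [z = y.+1], the relation sought is the translated or the untouched one. *)
have up : rise r (widen_ord (leqnSn n) y) (lift ord0 y).
  have [eq_y | lt_y] : y = x.+1 :> nat \/ x.+1 < y by lia.
    suff -> : widen_ord (leqnSn n) y = lift ord0 x by [].
    by apply: val_inj; rewrite /= eq_y.
  apply: (proj1 (intv (lift ord0 x) _ _ _ _)) incr; first by rewrite lift0.
  by rewrite lift0 /=.
have down : rise r (lift ord0 y) (widen_ord (leqnSn n) y).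
  have [eq_z | lt_z] : z = y.+1 :> nat \/ y.+1 < z by lia.
    suff -> : lift ord0 y = widen_ord (leqnSn n) z by [].
    by apply: val_inj; rewrite /= eq_z.
  apply: (proj2 (intv _ _ (widen_ord (leqnSn n) z) _ _)) decr;
    by rewrite lift0.
have /anti/(congr1 (@nat_of_ord _)) :
  rise r (widen_ord (leqnSn n) y) (lift ord0 y) &&
  rise r (lift ord0 y) (widen_ord (leqnSn n) y) by rewrite up down.
by rewrite lift0 /=; lia.
Qed.

Theorem lemma4p5 (n : nat) (r : rel 'I_n) (hr : interval_poset r) :
  interval_poset (rise r) <-> modern r.
Proof.
split=> [|mod_r]; first exact: modern_of_rise.
have anti := label_rel_anti hr; have trans := label_rel_trans hr.
have incr := label_rel_incr hr; have decr := label_rel_decr hr.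
have modl := label_rel_modern mod_r.
split.
- by move=> u; apply/riseP; apply: RiseRefl.
- move=> u v /andP[/riseP ruv /riseP rvu].
  exact/val_inj/(rise_label_anti anti incr decr modl ruv rvu).
- move=> v u w /riseP ruv /riseP rvw; apply/riseP.
  exact: (rise_label_trans anti trans incr decr modl ruv rvw).
- move=> a b c lt_ab lt_bc.
  have [up down] := rise_label_interval incr decr lt_ab lt_bc.
  by split=> /riseP H; apply/riseP; [apply: up | apply: down].
Qed.
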